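(* Let $q$ be such that $1/q$ is a prime power and set $\Bbbk:=\mathbb{F}_{1/q}$. Let $\lambda$ be a partition of $n$ and let $N\in\mathfrak{gl}_n(\Bbbk)$ be nilpotent with $\mathrm{JF}(N)=\lambda$. Let $\alpha=(\alpha_1,\dots,\alpha_k)$ be a weak composition of $n$. (i) For every semistandard tableau $T$ of shape $\lambda$ and content $\alpha$, $$\mathrm{wt}_q(T)=q^{n(\lambda)-n(\alpha)}\,\big|\{F\in\mathrm{Fl}_\alpha : F \text{ is strictly compatible with } N \text{ and } \mathrm{JF}(N;F)=T\}\big|.$$ (ii) Consequently, the coefficient of $x_1^{\alpha_1}\cdots x_k^{\alpha_k}$ in $W_\lambda(\mathbf{x};q)$ equals $q^{n(\lambda)-n(\alpha)}\,|\{F\in\mathrm{Fl}_\alpha : F\text{ is strictly compatible with }N\}|$.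
   Context: A weak composition of $n$ is a finite sequence $\alpha=(\alpha_1,\dots,\alpha_k)$ of nonnegative integers summing to $n$; for it, $n(\alpha):=\sum_i\binom{\alpha_i}{2}$ (the same formula defines $n(\lambda)$ for a partition $\lambda$). For a nilpotent endomorphism $N$ of a finite-dimensional vector space, $\mathrm{JF}(N)$ denotes the partition $\lambda$ with $\lambda_1+\cdots+\lambda_i=\dim\ker(N^i)$ for all $i\ge0$ (equivalently the conjugate of the partition of Jordan block sizes). $\mathrm{Fl}_\alpha$ is the set of chains $F=(0=F_0\subseteq F_1\subseteq\cdots\subseteq F_k=\Bbbk^n)$ of subspaces with $\dim F_i=\alpha_1+\cdots+\alpha_i$. $F$ and $N\in\mathfrak{gl}_n$ are strictly compatible if $N(F_i)\subseteq F_{i-1}$ for $1\le i\le k$; then $\mathrm{JF}(N;F)$ is the semistandard tableau $T$ of shape $\mathrm{JF}(N)$ and content $\alpha$ such that the boxes containing entries $\le i$ form the shape $T^{(i)}=\mathrm{JF}(N|_{F_i})$ for each $i$ (this is well-defined). For a semistandard tableau $T$, $T^{(j)}$ is the partition formed by the boxes with entries $\le j$ ($T^{(0)}=\varnothing$), with parts $T^{(j)}_i$. Define $[m]_q=1+q+\cdots+q^{m-1}$, $[m]_q!=[m]_q[m-1]_q\cdots[1]_q$, $\binom{m}{r}_q=\frac{[m]_q!}{[r]_q![m-r]_q!}$. The $q$-weight is $\mathrm{wt}_q(T)=\prod_{i,j\ge1}\binom{T^{(j)}_i-T^{(j)}_{i+1}}{T^{(j)}_i-T^{(j-1)}_i}_q$,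 and the $q$-Whittaker function is $W_\lambda(\mathbf{x};q)=\sum_{T}\mathrm{wt}_q(T)\prod_i x_i^{\#\{i\text{'s in }T\}}$, summed over semistandard tableaux $T$ of shape $\lambda$ with entries in $\mathbb{Z}_{>0}$. *)

(* Defs.v *)
From mathcomp Require Import all_boot all_order all_algebra.
Set Implicit Arguments. Unset Strict Implicit. Unset Printing Implicit Defensive.
Import GRing.Theory Num.Theory.
Local Open Scope ring_scope.

Definition is_partition (s : seq nat) : bool :=
  sorted geq s && all (fun x => 0 < x)%N s.

Definition nstat (s : seq nat) : nat := (\sum_(x <- s) 'C(x, 2))%N.

Definition row_of (T : seq (seq nat)) (r : nat) : seq nat := nth [::] T r.

Definition is_ssyt (T : seq (seq nat)) : bool :=
  [&& is_partition (shape T),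
      all (fun r => sorted leq r && all (fun x => 0 < x)%N r) T &
      all (fun r => all (fun c => nth 0 (row_of T r) c < nth 0 (row_of T r.+1) c)%N
                        (iota 0 (size (row_of T r.+1))))
          (iota 0 (size T))].

Definition has_content (T : seq (seq nat)) (alpha : seq nat) : bool :=
  all (fun i => count_mem i.+1 (flatten T) == nth 0 alpha i) (iota 0 (size alpha))
  && all (fun x => x <= size alpha)%N (flatten T).

(* T^(j)_{r+1} : number of boxes with entry <= j in row r+1 (r 0-based) *)
Definition Tsh (T : seq (seq nat)) (j r : nat) : nat :=
  count (fun x => x <= j)%N (row_of T r).

Definition max_entry (T : seq (seq nat)) : nat := (\max_(x <- flatten T) x)%N.

Definition qint (q : rat) (m : nat) : rat := \sum_(i < m) q ^+ i.
Definition qfact (q : rat) (m : nat) : rat := \prod_(i < m) qint q i.+1.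
Definition qbinom (q : rat) (m r : nat) : rat :=
  if (r <= m)%N then qfact q m / (qfact q r * qfact q (m - r)%N) else 0.

(* wt_q(T) = prod_{i,j>=1} binom_q(T^(j)_i - T^(j)_{i+1}, T^(j)_i - T^(j-1)_i).
   Factors with i > #rows or j > max entry are binom_q(m,0) = 1, so the product
   is taken over the finitely many remaining indices. *)
Definition wt (q : rat) (T : seq (seq nat)) : rat :=
  \prod_(r < size T) \prod_(1 <= j < (max_entry T).+1)
     qbinom q (Tsh T j r - Tsh T j r.+1)%N (Tsh T j r - Tsh T j.-1 r)%N.

Fixpoint words (m : nat) (s : seq nat) : seq (seq nat) :=
  match m with
  | 0 => [:: [::]]
  | m'.+1 => [seq x :: t | x <- s, t <- words m' s]
  end.

Definition fillings (lam : seq nat) (k : nat) : seq (seq (seq nat)) :=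
  foldr (fun m acc => [seq r :: t | r <- words m (iota 1 k), t <- acc]) [:: [::]] lam.

(* coefficient of x_1^{alpha_1} ... x_k^{alpha_k} in
   W_lam(x; q) = sum_{T SSYT of shape lam, entries in Z_{>0}} wt_q(T) x^T :
   only tableaux of content alpha contribute (these have entries <= k). *)
Definition W_coeff (q : rat) (lam alpha : seq nat) : rat :=
  \sum_(T <- fillings lam (size alpha) | is_ssyt T && has_content T alpha) wt q T.

(** * Flags, strict compatibility, Jordan type.
   Vectors of k^n are row vectors 'rV[F]_n; a matrix N acts by v |-> v *m N.
   A subspace is represented by its canonical matrix <<A>>%MS (so distinct
   subspaces <-> distinct representatives). *)

Section Flags.
Variables (F : finFieldType) (n : nat).

Definition is_flag (alpha : seq nat) (Fl : {ffun 'I_(size alpha).+1 -> 'M[F]_n}) : bool :=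
  [forall i : 'I_(size alpha).+1,
     (<<Fl i>>%MS == Fl i) && (\rank (Fl i) == \sum_(j < i) nth 0 alpha j)%N]
  && [forall i : 'I_(size alpha), (Fl (inord i) <= Fl (inord i.+1))%MS].

Definition strictly_compatible (N : 'M[F]_n) (alpha : seq nat)
    (Fl : {ffun 'I_(size alpha).+1 -> 'M[F]_n}) : bool :=
  [forall i : 'I_(size alpha), (Fl (inord i.+1) *m N <= Fl (inord i))%MS].

(* JF(N;F) = T : for every i, T^(i) = JF(N|_{F_i}), i.e. for every j,
   T^(i)_1 + ... + T^(i)_j = dim ker ((N|_{F_i})^j) = dim (F_i cap ker N^j).
   (Checking j <= n suffices: both partitions have at most n parts.) *)
Definition JF_flag_is (N : 'M[F]_n) (alpha : seq nat)
    (Fl : {ffun 'I_(size alpha).+1 -> 'M[F]_n}) (T : seq (seq nat)) : bool :=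
  [forall i : 'I_(size alpha).+1, forall j : 'I_n.+1,
     (\sum_(r < j) Tsh T i r)%N == \rank (Fl i :&: kermx (N ^+ j))%MS].

Definition JF_is (N : 'M[F]_n) (lam : seq nat) : Prop :=
  forall j : nat, (\sum_(r < j) nth 0 lam r)%N = \rank (kermx (N ^+ j)).

End Flags.
Arguments is_flag {F n} alpha Fl.

(* Main.v *)
Require Import Defs.
From mathcomp Require Import all_boot all_order all_algebra.
From mathcomp Require mxabelem.
From mathcomp Require Import ring zify.
Set Implicit Arguments. Unset Strict Implicit. Unset Printing Implicit Defensive.
Import Order.TTheory GRing.Theory Num.Theory.
Local Open Scope ring_scope.

(** Build the flag from the top.  Once [U = F_(j+1)] is fixed, of Jordan type [lam],
    the admissible [H = F_j] are the subspaces with [U N <= H <= U], and the Jordan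
    type [mu] of [H] is equivalent to the dimensions of the intersections of [H] with
    the partial flag [A_i = U N + (U :&: ker N^i)], where [dim A_i = |lam| - lam_(i+1)].
    So [H] runs over a Schubert cell in a Grassmannian of [U / U N], and the number of
    its points is a power of [|F|] times the product over [i] of the [q]-binomials
    [lam_i - lam_(i+1)] choose [lam_i - mu_i], [q = 1/|F|].  The exponents telescope to
    [n(lam) - n(alpha)].  For (ii), a strictly compatible flag has exactly one
    tableau, since the Jordan types of consecutive steps differ by horizontal strips. *)

(** * Counting subspaces with a prescribed intersection *)

Lemma card_rV_submx (F : finFieldType) (n : nat) (A : 'M[F]_n) :
  #|[set v : 'rV[F]_n | (v <= A)%MS]| = (#|F| ^ \rank A)%N.
Proof. exact: mxabelem.card_rowg. Qed.

Lemma card_rV_diff (F : finFieldType) (n : nat) (A B : 'M[F]_n) : (B <= A)%MS ->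
  #|[set v : 'rV[F]_n | (v <= A)%MS && ~~ (v <= B)%MS]|
    = (#|F| ^ \rank A - #|F| ^ \rank B)%N.
Proof.
move=> BA; rewrite -!card_rV_submx.
rewrite -(cardsID [set v : 'rV[F]_n | (v <= B)%MS] [set v : 'rV[F]_n | (v <= A)%MS]).
rewrite (_ : _ :&: _ = [set v : 'rV[F]_n | (v <= B)%MS]).
  by rewrite addKn; apply: eq_card => v; rewrite !inE andbC.
by apply/setP=> v; rewrite !inE andbC; case vB: (v <= B)%MS; rewrite // (submx_trans vB BA).
Qed.

Lemma mxrank_add_rV (F : fieldType) (n : nat) (A : 'M[F]_n) (v : 'rV[F]_n) :
  ~~ (v <= A)%MS -> \rank (A + v)%MS = (\rank A).+1.
Proof.
move=> vA; rewrite mxrank_disjoint_sum.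
  rewrite rank_rV (_ : v != 0) ?addn1 //; apply: contraNneq vA => ->; exact: sub0mx.
apply/eqP; rewrite -mxrank_eq0 -leqn0 -ltnS; rewrite ltn_neqAle.
have r1 : (\rank (A :&: v)%MS <= 1)%N.
  by apply: leq_trans (mxrankS (capmxSr A v)) _; rewrite rank_rV; case: eqP.
rewrite r1 andbT; apply: contraNneq vA => r2.
apply: submx_trans (capmxSl A v).
have /mxrank_leqif_sup <- := capmxSr A v.
by rewrite r2 rank_rV; case: (eqVneq v 0) r2 => // ->; rewrite capmx0 mxrank0.
Qed.

(** One stage of a Schubert cell: [e] is the dimension that [H] gains outside [B]. Asking [H] to be
    its own canonical matrix makes the cardinality count subspaces rather than matrices. *)
Definition extensions (F : finFieldType) (n : nat) (A B H' : 'M[F]_n) (e : nat) :=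
  [set H : 'M[F]_n | [&& <<H>>%MS == H, (H <= A)%MS, (H :&: B == H')%MS
     & \rank H == (\rank H' + e)%N]].

(** By the modular law, a space [H] through [v] with [H :&: B = H'] meets [B + v] in [H' + v].
    Conversely [H' + v] meets [B] in [H'], because the line of [v] meets [B] only in 0. Fixing a
    vector of [H] outside [B] thus lowers [e] by one, which drives the induction. *)
Lemma extensions_add_rV (F : finFieldType) (n : nat) (A B H' : 'M[F]_n) (e : nat)
    (v : 'rV[F]_n) :
  (H' <= B)%MS -> ~~ (v <= B)%MS ->
  extensions A (B + v)%MS (H' + v)%MS e =
  [set H in extensions A B H' e.+1 | (v <= H)%MS].
Proof.
move=> H'B vB; apply/setP => H; rewrite !inE.
have vH' : ~~ (v <= H')%MS by apply: contra vB => /submx_trans->.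
rewrite mxrank_add_rV // addSnnS.
case: (<<H>>%MS == H) => //=; case: (H <= A)%MS => //=.
set r := (\rank H == _); rewrite ![_ && r]andbC -[RHS]andbA; congr (_ && _).
apply/idP/idP => [/eqmxP cap|/andP[/eqmxP cap vH]].
  have vH : (v <= H)%MS.
    by apply: submx_trans (capmxSl H (B + v)%MS); rewrite cap addsmxSr.
  rewrite vH andbT; apply/andP; split; last first.
    rewrite sub_capmx H'B andbT.
    by apply: submx_trans (capmxSl H (B + v)%MS); rewrite cap addsmxSl.
  have : (H :&: B <= (H' + v) :&: B)%MS.
    rewrite sub_capmx capmxSr andbT -cap; exact: capmxS (submx_refl _) (addsmxSl _ _).
  rewrite -(matrix_modl v H'B) => /submx_trans; apply.
  suff -> : (v :&: B)%MS = 0 by rewrite addsmx0.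
  apply/eqP; apply/negPn; apply: contra vB => nz.
  apply: submx_trans (capmxSr v B).
  have /mxrank_leqif_sup <- := capmxSl v B.
  rewrite eqn_leq mxrankS ?capmxSl //= (leq_trans (rank_leq_row _)) //.
  by rewrite lt0n mxrank_eq0.
apply/eqmxP; apply: eqmx_trans (adds_eqmx cap (eqmx_refl v)).
exact/eqmx_sym/matrix_modr.
Qed.

Lemma card_extensions0 (F : finFieldType) (n : nat) (A B H' : 'M[F]_n) :
  (H' <= B)%MS -> (B <= A)%MS -> #|extensions A B H' 0| = 1%N.
Proof.
move=> H'B BA; apply/eqP/cards1P; exists <<H'>>%MS; apply/setP=> H; rewrite !inE addn0.
apply/and4P/eqP => [[/eqP HE HA /eqmxP cap rk]|->].
  have H'H : (H' <= H)%MS by apply: submx_trans (capmxSl H B); rewrite cap.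
  rewrite -HE; apply/genmxP; rewrite H'H andbT.
  by have /mxrank_leqif_sup <- := H'H; rewrite (eqP rk).
split; [by rewrite genmx_id | by rewrite genmxE (submx_trans H'B) | | by rewrite genmxE].
by apply/eqmxP; apply: eqmx_trans (cap_eqmx (genmxE _) (eqmx_refl B)) _; exact/capmx_idPl.
Qed.

(* Double counting of the pairs [(v, H)] with [v] in [H] but not in [B]. *)
Lemma card_extensionsS (F : finFieldType) (n : nat) (A B H' : 'M[F]_n) (e : nat) :
  (H' <= B)%MS ->
  (#|extensions A B H' e.+1| * (#|F| ^ (\rank H' + e.+1) - #|F| ^ \rank H')
   = \sum_(v : 'rV[F]_n | (v <= A)%MS && ~~ (v <= B)%MS)
        #|extensions A (B + v)%MS (H' + v)%MS e|)%N.
Proof.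
move=> H'B.
under eq_bigr => v /andP[_ vB] do rewrite (extensions_add_rV _ _ H'B vB) -sum1_card.
rewrite -sum_nat_const.
(* Since [H :&: B = H'], the vectors of [H] outside [B] are those outside [H'], so their number is
   the same for every [H]. *)
have E H : H \in extensions A B H' e.+1 -> (#|F| ^ (\rank H' + e.+1) - #|F| ^ \rank H' =
    \sum_(v : 'rV[F]_n | [&& (v <= A)%MS, ~~ (v <= B)%MS & (v <= H)%MS]) 1)%N.
  rewrite !inE => /and4P[_ HA /eqmxP cap /eqP rk].
  have H'H : (H' <= H)%MS by apply: submx_trans (capmxSl H B); rewrite cap.
  rewrite -rk -(card_rV_diff H'H) -sum1_card; apply: eq_bigl => v; rewrite !inE.
  rewrite -cap sub_capmx; case vH: (v <= H)%MS; rewrite ?andbF ?andbT //=.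
  by rewrite (submx_trans vH HA).
under eq_bigr => H HE do rewrite (E H HE).
rewrite (exchange_big_dep (fun v : 'rV_n => (v <= A)%MS && ~~ (v <= B)%MS)) /=; last first.
  by move=> H v _ /and3P[-> ->].
apply: eq_bigr => v /andP[vA vB]; apply: eq_bigl => H.
by rewrite [RHS]inE vA vB.
Qed.

(** The right side is the number of [e]-tuples in [A] that are independent modulo [B]; the product
    on the left is the number of those lying in one given [H]. The induction on [e] picks the tuple
    one vector at a time. *)
Lemma card_extensions_prod (F : finFieldType) (n : nat) (e : nat) (A B H' : 'M[F]_n) :
  (H' <= B)%MS -> (B <= A)%MS -> (\rank B + e <= \rank A)%N ->
  let Q : rat := #|F|%:R in
  #|extensions A B H' e|%:R * (\prod_(i < e) (Q ^+ (\rank H' + e) - Q ^+ (\rank H' + i)))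
  = \prod_(i < e) (Q ^+ \rank A - Q ^+ (\rank B + i)).
Proof.
move=> + + + Q; have F_gt0 : (0 < #|F|)%N by apply/card_gt0P; exists 0.
elim: e B H' => [|e IHe] B H' H'B BA bea.
  by rewrite card_extensions0 // !big_ord0 mulr1.
rewrite 2!big_ord_recl /= !addn0 mulrA.
have natrQ m p : (m <= p)%N -> (#|F| ^ p - #|F| ^ m)%N%:R = Q ^+ p - Q ^+ m.
  by move=> mp; rewrite natrB ?leq_pexp2l // !natrX.
rewrite -natrQ ?leq_addr // -natrM card_extensionsS // natr_sum mulr_suml.
(* The first factor on the right becomes a sum over the vectors of [A] outside [B], to be matched
   term by term with the double count. *)
rewrite -natrQ ?mxrankS // -card_rV_diff // -sum1_card natr_sum mulr_suml.
apply: eq_big => [v|v /andP[vA vB]]; first by rewrite inE.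
have vH' : ~~ (v <= H')%MS by apply: contra vB => /submx_trans->.
rewrite mul1r; have := IHe (B + v)%MS (H' + v)%MS.
rewrite !mxrank_add_rV // => /(_ (addsmxS H'B (submx_refl _))).
rewrite addsmx_sub BA vA addSnnS => /(_ isT bea).
move=> IH; transitivity (\prod_(i < e) (Q ^+ \rank A - Q ^+ ((\rank B).+1 + i))); last first.
  by apply: eq_bigr => i _; rewrite addSnnS.
rewrite -IH; congr (_ * _).
by apply: eq_bigr => i _; rewrite !addSnnS.
Qed.

(** * From powers of [Q] to [q]-binomials at [q = 1/Q] *)

Lemma qint_gt0 (q : rat) (m : nat) : 0 < q -> 0 < qint q m.+1.
Proof.
move=> q_gt0; rewrite /qint big_ord_recl expr0 ltr_pwDl //.
by apply: sumr_ge0 => i _; rewrite exprn_ge0 // ltW.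
Qed.

Lemma qfact_gt0 (q : rat) (m : nat) : 0 < q -> 0 < qfact q m.
Proof. by move=> q_gt0; apply: prodr_gt0 => i _; exact: qint_gt0. Qed.

Lemma qfact_prod (q : rat) (d e : nat) : (e <= d)%N ->
  qfact q d = qfact q (d - e) * \prod_(i < e) qint q (d - i).
Proof.
elim: e => [|e IHe] ed; first by rewrite subn0 big_ord0 mulr1.
rewrite IHe 1?ltnW // big_ord_recr /= mulrCA mulrC; congr (_ * _).
by rewrite /qfact -subnSK // big_ord_recr.
Qed.

(** After cancelling [qfact q (d - e)], numerator and denominator have [e] factors each, which is
    the shape of the two products in [card_extensions_prod]. *)
Lemma qbinom_prod (q : rat) (d e : nat) : 0 < q -> (e <= d)%N ->
  qbinom q d e * \prod_(i < e) qint q (e - i) = \prod_(i < e) qint q (d - i).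
Proof.
move=> q_gt0 ed; rewrite /qbinom ed (qfact_prod q ed).
rewrite (qfact_prod q (leqnn e)) subnn [qfact q 0]big_ord0 mul1r.
have := qfact_gt0 (d - e) q_gt0; have := qfact_gt0 e q_gt0.
rewrite (qfact_prod q (leqnn e)) subnn [qfact q 0]big_ord0 mul1r.
by move=> /gt_eqF/negbT h1 /gt_eqF/negbT h2; field; rewrite h1 h2.
Qed.

Lemma qbinom_sub (q : rat) (d e : nat) : (e <= d)%N ->
  qbinom q d (d - e) = qbinom q d e.
Proof. by move=> ed; rewrite /qbinom leq_subr ed subKn // [qfact q e * _]mulrC. Qed.

Lemma qbinomn0 (q : rat) (d : nat) : 0 < q -> qbinom q d 0 = 1.
Proof. by move=> q0; have := qbinom_prod q0 (leq0n d); rewrite !big_ord0 mulr1. Qed.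

(** Factoring out the larger power leaves [1 - q ^+ (a - b)] with [q = 1/Q], a geometric sum times
    [1 - q]. *)
Lemma exprB_qint (Q : rat) (a b : nat) : Q != 0 -> (b <= a)%N ->
  Q ^+ a - Q ^+ b = Q ^+ a * ((1 - Q^-1) * qint Q^-1 (a - b)).
Proof.
move=> Q0 ba; have -> : (1 - Q^-1) * qint Q^-1 (a - b) = 1 - Q^-1 ^+ (a - b).
  by rewrite -[LHS]opprK -mulNr opprB -subrX1 opprB.
rewrite mulrBr mulr1; congr (_ - _).
by rewrite -{1}(subnK ba) [X in Q ^+ X * _]addnC exprD exprVn mulfK // expf_neq0.
Qed.

(** Each of the [e] numerator factors yields [Q ^+ \rank A] and each of the [e] denominator factors
    [Q ^+ (\rank H' + e)], whence the exponent. The powers of [1 - q] cancel and the remaining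
    [q]-integers form the [q]-binomial. *)
Lemma card_extensions (F : finFieldType) (n : nat) (e : nat) (A B H' : 'M[F]_n) :
  (H' <= B)%MS -> (B <= A)%MS -> (\rank B + e <= \rank A)%N ->
  let Q : rat := #|F|%:R in
  #|extensions A B H' e|%:R = Q ^+ (e * (\rank A - \rank H' - e))
    * qbinom Q^-1 (\rank A - \rank B) e.
Proof.
move=> H'B BA bea Q; have Q_gt1 : 1 < Q by rewrite ltr1n card_finNzRing_gt1.
have Q_gt0 : 0 < Q := lt_trans ltr01 Q_gt1; have Q0 := lt0r_neq0 Q_gt0.
have q_gt0 : 0 < Q^-1 by rewrite invr_gt0.
have q1 : 1 - Q^-1 != 0 by rewrite subr_eq0 eq_sym invr_eq1 gt_eqF.
have hb := mxrankS H'B.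
set c := \prod_(i < e) (Q ^+ (\rank H' + e) - Q ^+ (\rank H' + i)).
have Ec : c = (Q ^+ (\rank H' + e) * (1 - Q^-1)) ^+ e * \prod_(i < e) qint Q^-1 (e - i).
  rewrite -[X in _ ^+ X](card_ord e) -prodr_const -big_split; apply: eq_bigr => i _ /=.
  by rewrite exprB_qint ?leq_add2l 1?ltnW // subnDl mulrA.
have c0 : c != 0.
  rewrite Ec mulf_neq0 ?expf_neq0 ?mulf_neq0 ?expf_neq0 //.
  apply/prodf_neq0 => i _; rewrite -subnSK //; exact/lt0r_neq0/qint_gt0.
apply: (mulIf c0); rewrite {1}/c card_extensions_prod // -/Q Ec.
rewrite mulrACA qbinom_prod ?leq_subRL ?mxrankS //.
transitivity (\prod_(i < e) (Q ^+ \rank A * (1 - Q^-1) * qint Q^-1 (\rank A - \rank B - i))).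
  apply: eq_bigr => i _; rewrite exprB_qint // ?subnDA ?mulrA //.
  by apply: leq_trans bea; rewrite leq_add2l ltnW.
rewrite big_split prodr_const card_ord; congr (_ * _).
rewrite !exprMn mulrA; congr (_ * _).
rewrite mulnC exprM -exprMn -exprD; congr (_ ^+ _ ^+ _); lia.
Qed.

(** * Schubert cells *)

Definition schubert_cell (F : finFieldType) (n : nat) (A : nat -> 'M[F]_n)
    (h : nat -> nat) (m : nat) :=
  [set H : 'M[F]_n | [&& <<H>>%MS == H, (H <= A m)%MS
     & [forall i : 'I_m.+1, \rank (H :&: A i)%MS == h i]]].

(** Induction on [m]: send [H] to [H :&: A m]. Each fibre over the smaller cell is a set of
    [extensions], whose size depends on dimensions only. The condition on [h 0] forces [A 0] into
    [H], so the case [m = 0] is a single point. *)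
Lemma card_schubert_cell (F : finFieldType) (n : nat) (A : nat -> 'M[F]_n)
    (h : nat -> nat) (m : nat) :
  (forall i, (i < m)%N -> (A i <= A i.+1)%MS) -> h 0 = \rank (A 0) ->
  (forall i, (i < m)%N -> (h i <= h i.+1)%N) ->
  (forall i, (i < m)%N -> (\rank (A i) + h i.+1 <= \rank (A i.+1) + h i)%N) ->
  let Q : rat := #|F|%:R in
  #|schubert_cell A h m|%:R =
    \prod_(i < m) (Q ^+ ((h i.+1 - h i) * (\rank (A i.+1) - h i.+1))
      * qbinom Q^-1 (\rank (A i.+1) - \rank (A i)) (h i.+1 - h i)).
Proof.
move=> + h0 + + Q; elim: m => [|m IHm] mA mh ah.
  rewrite big_ord0; apply/eqP; rewrite pnatr_eq1; apply/cards1P.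
  exists <<A 0>>%MS; apply/setP=> H; rewrite !inE.
  apply/and3P/eqP => [[/eqP HE HA /forallP/(_ ord0)/eqP /= rk]|->].
    rewrite -HE; apply/genmxP; rewrite HA.
    apply: submx_trans (capmxSl H (A 0)).
    by have /mxrank_leqif_sup <- := capmxSr H (A 0); rewrite rk h0.
  split; [by rewrite genmx_id|by rewrite genmxE|].
  apply/forallP => i; rewrite ord1 h0 (cap_eqmx (genmxE _) (eqmx_refl _)) /=.
  exact/eqP/eqmx_rank/eqmxP/capmx_idPl/submx_refl.
(* The conditions at levels up to [m] see only [H :&: A m], so they hold for the whole fibre at
   once. *)
have capm (H : 'M[F]_n) i : (i < m.+1)%N ->
    \rank (H :&: A m :&: A i)%MS = \rank (H :&: A i)%MS.
  move=> im; rewrite -capmxA; apply: eqmx_rank; apply/eqmxP.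
  apply: cap_eqmx (eqmx_refl _) _; apply/capmx_idPr.
  have sub j : (i + j <= m)%N -> (A i <= A (i + j)%N)%MS.
    elim: j => [|j IHj] ij; first by rewrite addn0.
    apply: submx_trans (IHj _) _; first by lia.
    by rewrite addnS mA //; lia.
  by rewrite -(subnKC (im : i <= m)%N) sub // subnKC.
have IH := IHm (fun i im => mA i (ltnW im)) (fun i im => mh i (ltnW im))
  (fun i im => ah i (ltnW im)).
rewrite big_ord_recr /= -IH mulr_natl -[in LHS]sum1_card.
rewrite (partition_big (fun H : 'M[F]_n => <<H :&: A m>>%MS)
    (fun H => H \in schubert_cell A h m)) /=; last first.
  move=> H; rewrite !inE => /and3P[_ _ /forallP rk].
  rewrite genmx_id eqxx genmxE capmxSr /=; apply/forallP => i.
  by rewrite (cap_eqmx (genmxE _) (eqmx_refl _)) capm // (rk (widen_ord (leqnSn _) i)).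
rewrite natr_sum -sumr_const; apply: eq_bigr => H'.
rewrite inE => /and3P[/eqP cH' H'A /forallP rk'].
have rkm : \rank H' = h m.
  rewrite -(eqP (rk' ord_max)) /=; apply: eqmx_rank; apply/eqmxP/eqmx_sym/capmx_idPl.
  exact: H'A.
have le1 := mh m (leqnn _); have le2 := ah m (leqnn _).
have -> : (\rank (A m.+1) - h m.+1 = \rank (A m.+1) - \rank H' - (h m.+1 - h m))%N by lia.
rewrite -card_extensions ?mA //; last by lia.
rewrite sum1_card; congr (_%:R); apply: eq_card => H; rewrite !inE unfold_in /=.
have -> : (<<H :&: A m>>%MS == H') = (H :&: A m == H')%MS.
  by rewrite -{1}cH'; apply/eqP/genmxP.
rewrite inE.
case: (<<H>>%MS == H) => //=; case HA: (H <= A m.+1)%MS => //=.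
rewrite andbC; case E: (H :&: A m == H')%MS => //=.
have /eqmxP cap := E.
rewrite rkm subnKC //; apply/forallP/eqP => [/(_ ord_max) /eqP <-|rkH i] /=.
  by apply/eqmx_rank/eqmxP/eqmx_sym/capmx_idPl.
case: (ltngtP i m.+1) => [im|im|->].
- rewrite -capm // (cap_eqmx cap (eqmx_refl _)).
  exact: (rk' (Ordinal im)).
- by have := ltn_ord i; rewrite ltnNge im.
by rewrite -rkH; apply/eqP/eqmx_rank/eqmxP/capmx_idPl.
Qed.

(** * One step of a flag *)

Definition psum (f : nat -> nat) (i : nat) : nat := (\sum_(r < i) f r)%N.

Lemma psum0 f : psum f 0 = 0%N.
Proof. exact: big_ord0. Qed.

Lemma psumS f i : psum f i.+1 = (psum f i + f i)%N.
Proof. exact: big_ord_recr. Qed.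

Lemma psum1 f : psum f 1 = f 0.
Proof. by rewrite psumS psum0. Qed.

Lemma psumB (lam mu : nat -> nat) (m : nat) : (forall r, (r < m)%N -> (mu r <= lam r)%N) ->
  (psum mu m + psum (fun r => lam r - mu r) m = psum lam m)%N.
Proof.
elim: m => [|m IHm] mu_lam; first by rewrite !psum0.
have := IHm (fun r rm => mu_lam r (ltnW rm)); have := mu_lam m (leqnn _).
rewrite !psumS; lia.
Qed.

(** A vector [u *m N] is killed by [N ^+ i] exactly when [u] is killed by [N ^+ i.+1]. *)
Lemma cap_ker_expS_mul (F : fieldType) (n : nat) (N U : 'M[F]_n) (i : nat) :
  ((U :&: kermx (N ^+ i.+1)) *m N :=: (U *m N) :&: kermx (N ^+ i))%MS.
Proof.
apply/eqmxP/andP; split.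
  rewrite sub_capmx submxMr ?capmxSl //= sub_kermx -mulmxA mulmxE -exprS -sub_kermx.
  exact: capmxSr.
apply/rV_subP => v; rewrite sub_capmx => /andP[/submxP[D ->]].
rewrite sub_kermx mulmxA -mulmxA mulmxE -exprS -sub_kermx => DU.
by rewrite submxMr // sub_capmx submxMl.
Qed.

Lemma ker_exp0 (F : fieldType) (n : nat) (N : 'M[F]_n) : kermx (N ^+ 0) = 0.
Proof. by apply/eqP; rewrite kermx_eq0 expr0 row_free_unit (unitmx1 F n). Qed.

Lemma ker_exp_le (F : fieldType) (n : nat) (N : 'M[F]_n) (i j : nat) : (i <= j)%N ->
  (kermx (N ^+ i) <= kermx (N ^+ j))%MS.
Proof.
move=> ij; rewrite sub_kermx -(subnKC ij) exprD -mulmxE mulmxA.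
by rewrite mulmx_ker mul0mx.
Qed.

Definition step_space (F : fieldType) (n : nat) (N U : 'M[F]_n) (i : nat) : 'M[F]_n :=
  (U *m N + U :&: kermx (N ^+ i))%MS.

Section StepRank.
Variables (F : fieldType) (n m : nat) (N U : 'M[F]_n) (lam : nat -> nat).
Hypothesis UN : (U *m N <= U)%MS.
Hypothesis rkU : forall j, (j <= m.+1)%N ->
  \rank (U :&: kermx (N ^+ j))%MS = (psum lam j)%N.

Local Notation A := (step_space N U).

(** As [U *m N <= H], the modular law gives [H :&: A i = U *m N + H :&: kermx (N ^+ i)]. Its
    summands meet in the image under [N] of [U :&: kermx (N ^+ i.+1)], of dimension
    [psum lam i.+1 - lam 0]; the [lam 0] cancels against [\rank (U *m N) = \rank U - lam 0]. *)
Lemma rank_cap_step (H : 'M[F]_n) (i : nat) : (i <= m)%N ->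
  (U *m N <= H)%MS -> (H <= U)%MS ->
  (\rank (H :&: A i)%MS + psum lam i.+1
   = \rank U + \rank (H :&: kermx (N ^+ i))%MS)%N.
Proof.
move=> im UNH HU.
have -> : \rank (H :&: A i)%MS = \rank (U *m N + H :&: kermx (N ^+ i))%MS.
  apply: eqmx_rank; apply/eqmxP; rewrite capmxC.
  apply: eqmx_trans (eqmx_sym (matrix_modl _ UNH)) _.
  apply: adds_eqmx (eqmx_refl _) _.
  by rewrite capmxC capmxA; apply: cap_eqmx (eqmx_refl _); exact/capmx_idPl.
have E1 := mxrank_sum_cap (U *m N) (H :&: kermx (N ^+ i))%MS.
have E2 := mxrank_mul_ker U N.
have E3 := mxrank_mul_ker (U :&: kermx (N ^+ i.+1))%MS N.
have k1 : kermx N = kermx (N ^+ 1) by rewrite expr1.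
have E4 : \rank (U :&: kermx N)%MS = lam 0 by rewrite k1 rkU // psum1.
have E5 : \rank (U :&: kermx (N ^+ i.+1) :&: kermx N)%MS = lam 0.
  rewrite -E4 -capmxA; apply: eqmx_rank; apply/eqmxP.
  by apply: cap_eqmx (eqmx_refl _) _; apply/capmx_idPr; rewrite k1 ker_exp_le.
have E6 : \rank (U *m N :&: (H :&: kermx (N ^+ i)))%MS
    = \rank ((U :&: kermx (N ^+ i.+1)) *m N)%MS.
  rewrite cap_ker_expS_mul capmxA; apply: eqmx_rank; apply/eqmxP.
  by apply: cap_eqmx (eqmx_refl _); exact/capmx_idPl.
rewrite -rkU //; lia.
Qed.

(** The case [H = U] of [rank_cap_step]. Consecutive spaces [A i] and [A i.+1] thus differ in
    dimension by [lam i - lam i.+1], the upper index of the [q]-binomial. *)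
Lemma rank_step (i : nat) : (i <= m)%N -> (\rank (A i) + lam i = \rank U)%N.
Proof.
move=> im; have AU : (A i <= U)%MS by rewrite addsmx_sub UN capmxSl.
have := rank_cap_step im UN (submx_refl U).
rewrite (eqmx_rank (introT eqmxP (capmx_idPr AU))) rkU 1?leqW // psumS /=; lia.
Qed.

End StepRank.

(** The two interlacing inequalities are the hypotheses of [card_schubert_cell]: [lam r.+1 <= mu r]
    makes [h] weakly increasing, and [mu r <= lam r] keeps its increments below those of the
    dimensions of the flag. *)
Lemma card_step (F : finFieldType) (n m : nat) (N U : 'M[F]_n) (lam mu : nat -> nat) :
  (U *m N <= U)%MS -> (U <= kermx (N ^+ m))%MS ->
  (forall j, (j <= m.+1)%N ->
     \rank (U :&: kermx (N ^+ j))%MS = (psum lam j)%N) ->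
  (forall r, (r < m)%N -> (lam r.+1 <= mu r <= lam r)%N) ->
  let Q : rat := #|F|%:R in
  #|[set H : 'M[F]_n | [&& <<H>>%MS == H, (H <= U)%MS, (U *m N <= H)%MS
      & [forall j : 'I_m.+1, \rank (H :&: kermx (N ^+ j))%MS == (psum mu j)%N]]]|%:R
  = \prod_(i < m) (Q ^+ ((mu i - lam i.+1) * psum (fun r => lam r - mu r)%N i.+1)
      * qbinom Q^-1 (lam i - lam i.+1) (lam i - mu i)).
Proof.
move=> UN Um rkU lam_mu Q.
(* The dimension of [H :&: A i] that [rank_cap_step] dictates when [H] has type [mu]. *)
pose h i := (\rank U + psum mu i - psum lam i.+1)%N.
have sums i : (i <= m)%N ->
    (psum mu i + psum (fun r => lam r - mu r) i = psum lam i)%N.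
  by move=> im; apply: psumB => r ri; case/andP: (lam_mu r (leq_trans ri im)).
have le_U i : (i <= m.+1)%N -> (psum lam i <= \rank U)%N.
  by move=> im; rewrite -rkU // mxrankS ?capmxSl.
have A0 : (step_space N U 0 :=: U *m N)%MS.
  by rewrite /step_space ker_exp0; apply/addsmx_idPl; rewrite capmx0 sub0mx.
have Amax : (step_space N U m :=: U)%MS.
  apply/eqmxP; rewrite addsmx_sub UN capmxSl /=.
  by apply: submx_trans (addsmxSr _ _); rewrite sub_capmx submx_refl.
transitivity (#|schubert_cell (step_space N U) h m|%:R : rat).
  congr (_%:R); apply: eq_card => H; rewrite !inE Amax.
  case: eqP => //= _; case HU: (H <= U)%MS => //=.
  apply/andP/forallP => [[UNH /forallP rkH] i|rkH].
    have := rank_cap_step UN rkU (ltn_ord i : (i <= m)%N) UNH HU.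
    rewrite (eqP (rkH i)) /h => E; apply/eqP; lia.
  (* The cell condition at level 0 recovers this inclusion, since [A 0] is [U *m N] and [h 0] is its
     full dimension. *)
  have UNH : (U *m N <= H)%MS.
    apply: submx_trans (capmxSl H (step_space N U 0)).
    rewrite -A0; have /mxrank_leqif_sup <- := capmxSr H (step_space N U 0).
    have := rank_step UN rkU (leq0n m); rewrite (eqP (rkH ord0)) /h /= psum0 psum1 => E.
    by rewrite addn0 -E addnK.
  split=> //; apply/forallP => i /=.
  have := rank_cap_step UN rkU (ltn_ord i : (i <= m)%N) UNH HU; rewrite (eqP (rkH i)) /h.
  by have le := le_U i.+1 (ltn_ord i); rewrite subnK ?(leq_trans le) ?leq_addr // => /addnI <-.
rewrite card_schubert_cell.
- apply: eq_bigr => i _; have im := ltn_ord i.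
  have := rank_step UN rkU im; have := rank_step UN rkU (ltnW im); have := lam_mu _ im.
  have := le_U _ (im : (i.+2 <= m.+1)%N); have := sums _ im.
  rewrite /h !psumS /= => E1 E2 E3 E4 E5.
  have -> : (\rank (step_space N U i.+1) - \rank (step_space N U i) = lam i - lam i.+1)%N by lia.
  (* The cell count chooses [mu i - lam i.+1], the complement of [lam i - mu i] in
     [lam i - lam i.+1]. *)
  rewrite -(qbinom_sub _ (e := (lam i - mu i)%N)) //; last by lia.
  congr (_ ^+ _ * qbinom _ _ _); last by lia.
  congr (_ * _)%N; lia.
- by move=> i im; rewrite addsmxS ?capmxS ?ker_exp_le.
- by have := rank_step UN rkU (leq0n m); rewrite /h psum0 psum1 => <-; rewrite addn0 addnK.
- move=> i im; have := lam_mu _ im; rewrite /h !psumS /=; lia.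
- move=> i im; have := rank_step UN rkU im; have := rank_step UN rkU (ltnW im); have := lam_mu _ im.
  have := le_U _ (im : (i.+2 <= m.+1)%N).
  rewrite /h !psumS /=; lia.
Qed.

(** * Chains of flags *)

Section Chains.
Variables (X : finType) (P : nat -> pred X) (R : rel X).

Definition chain k (f : {ffun 'I_k.+1 -> X}) : bool :=
  [forall i : 'I_k.+1, P i (f i)] && [forall i : 'I_k, R (f (inord i)) (f (inord i.+1))].

Lemma chainP k (f : {ffun 'I_k.+1 -> X}) :
  reflect ((forall j, (j <= k)%N -> P j (f (inord j))) /\
           (forall j, (j < k)%N -> R (f (inord j)) (f (inord j.+1)))) (chain f).
Proof.
apply: (iffP andP) => -[/= hP hR]; split.
- by move=> j jk; have /forallP/(_ (inord j)) := hP; rewrite inordK.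
- by move=> j jk; have /forallP/(_ (Ordinal jk)) := hR.
- by apply/forallP => i; have := hP i (ltn_ord i); rewrite inord_val.
- by apply/forallP => i; exact: hR.
Qed.

(** The number of predecessors depends only on the level, so the choices made downwards from [U]
    multiply. The induction sorts the chains by their entry just below the top. *)
Lemma card_chains (w : nat -> rat) k U :
  #|[set x | P 0 x]| = 1%N ->
  (forall j V, (j < k)%N -> P j.+1 V -> #|[set H | P j H & R H V]|%:R = w j) ->
  P k U ->
  #|[set f : {ffun 'I_k.+1 -> X} | chain f & f ord_max == U]|%:R = \prod_(j < k) w j.
Proof.
move=> P0; elim: k U => [|k IHk] U hw PU.
  rewrite big_ord0; apply/eqP; rewrite pnatr_eq1; apply/cards1P.
  exists [ffun _ => U]; apply/setP => f; rewrite !inE.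
  apply/andP/eqP => [[_ /eqP fU]|->]; last first.
    by split; [apply/chainP; split=> // -[|]//; rewrite ffunE | rewrite ffunE].
  by apply/ffunP => i; rewrite ffunE -fU; congr (f _); apply: val_inj; rewrite !ord1.
rewrite big_ord_recr /= -(hw k U) // mulr_natr -[in LHS]sum1_card.
rewrite (partition_big (fun f : {ffun _ -> X} => f (inord k))
    (fun H => H \in [set H | P k H & R H U])) /=.
  rewrite natr_sum -sumr_const; apply: eq_bigr => H; rewrite inE => /andP[PH RH].
  rewrite -(IHk H) //; last by move=> j V jk; apply: hw; rewrite ltnW.
  (* [ext] puts [U] on top of a chain and [res] drops the top entry; they are inverse on chains
     ending in [U]. *)
  pose ext (f : {ffun 'I_k.+1 -> X}) : {ffun 'I_k.+2 -> X} :=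
    [ffun i : 'I_k.+2 => if (i <= k)%N then f (inord i) else U].
  pose res (f : {ffun 'I_k.+2 -> X}) : {ffun 'I_k.+1 -> X} := [ffun i : 'I_k.+1 => f (inord i)].
  have extl f j : (j <= k)%N -> ext f (inord j) = f (inord j).
    by move=> jk; rewrite ffunE inordK ?jk // ltnS ltnW.
  have extr f : ext f (inord k.+1) = U by rewrite ffunE inordK ?ltnn.
  have maxE m : ord_max = inord m :> 'I_m.+1 by apply: val_inj; rewrite /= inordK.
  rewrite (reindex_onto ext res) /=; last first.
    move=> f; rewrite !inE => /andP[/andP[_ /eqP fU] _].
    apply/ffunP => i; rewrite !ffunE; case: leqP => ik.
      by rewrite inordK ?inord_val.
    by rewrite -fU; congr (f _); apply: val_inj => /=; have := ltn_ord i; lia.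
  rewrite -sum1_card; congr (_%:R); apply: eq_bigl => f; rewrite !inE !maxE extr eqxx andbT extl //.
  have -> : res (ext f) = f.
    apply/ffunP => i; have ik : (i <= k)%N by rewrite -ltnS.
    by rewrite ffunE extl // inord_val.
  rewrite eqxx andbT; case: eqP => fH; rewrite ?andbF // !andbT.
  apply/chainP/chainP => -[hP hR]; split=> j jk.
  - by rewrite -extl //; apply: hP; rewrite leqW.
  - by rewrite -!extl // 1?ltnW //; apply: hR; rewrite ltnW.
  - case: (ltngtP j k.+1) jk => // [jk _|-> _]; last by rewrite extr.
    by rewrite extl //; exact: hP.
  - move: jk; rewrite ltnS; case: (ltngtP j k) => // [jk _|-> _].
      by rewrite !extl // 1?ltnW //; exact: hR.
    by rewrite extl // extr fH.
move=> f; rewrite !inE => /andP[/chainP[hP hR] /eqP fU].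
rewrite hP //=; have := hR k (leqnn _).
by congr (R _ _); rewrite -fU; congr (f _); apply: val_inj; rewrite /= inordK.
Qed.
End Chains.

(** * Telescoping of the exponents *)

Lemma bin2D (a b : nat) : 'C(a + b, 2) = ('C(a, 2) + 'C(b, 2) + a * b)%N.
Proof.
elim: b => [|b IHb]; first by rewrite addn0 muln0 bin0n !addn0.
by rewrite addnS !binS !bin1 IHb; lia.
Qed.

(** For [lam m = 0] this says that the exponent in [card_step] is [n(lam) - n(mu)] minus the
    binomial of the size of the strip. The boundary term [lam m * S m] is what lets the identity
    pass through the intermediate stages of the induction. *)
Lemma nstat_interlacing (lam mu : nat -> nat) (m : nat) :
  (forall r, (r < m)%N -> (lam r.+1 <= mu r <= lam r)%N) ->
  let S := psum (fun r => lam r - mu r)%N in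
  (psum (fun i => (mu i - lam i.+1) * S i.+1) m + psum (fun i => 'C(mu i, 2)) m
     + 'C(S m, 2) + lam m * S m
   = psum (fun i => 'C(lam i, 2)) m)%N.
Proof.
move=> + S; elim: m => [|m IHm] lam_mu; first by rewrite !psum0 /S psum0 muln0.
have := IHm (fun r rm => lam_mu r (ltnW rm)); have /andP[l1 l2] := lam_mu m (leqnn _).
rewrite !psumS; have -> : S m.+1 = (S m + (lam m - mu m))%N by rewrite {1}/S psumS.
move: (S m) => s <-; move: (psum _ m) (psum _ m) => x y.
(* Writing [mu m = l + t] and [lam m = l + t + a] removes the truncated subtractions and leaves a
   polynomial identity. *)
have [a ->] : exists a, lam m = (mu m + a)%N by exists (lam m - mu m)%N; lia.
have [t ->] : exists t, mu m = (lam m.+1 + t)%N by exists (mu m - lam m.+1)%N; lia.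
move: (lam m.+1) => l; rewrite !(addKn, bin2D); lia.
Qed.

Lemma card_step_exp (F : finFieldType) (n m : nat) (N U : 'M[F]_n) (lam mu : nat -> nat) :
  (U *m N <= U)%MS -> (U <= kermx (N ^+ m))%MS ->
  (forall j, (j <= m.+1)%N -> \rank (U :&: kermx (N ^+ j))%MS = psum lam j) ->
  (forall r, (r < m)%N -> (lam r.+1 <= mu r <= lam r)%N) -> lam m = 0%N ->
  let Q : rat := #|F|%:R in
  #|[set H : 'M[F]_n | [&& <<H>>%MS == H, (H <= U)%MS, (U *m N <= H)%MS
      & [forall j : 'I_m.+1, \rank (H :&: kermx (N ^+ j))%MS == psum mu j]]]|%:R
    * Q ^+ (psum (fun i => 'C(mu i, 2)) m + 'C(psum lam m - psum mu m, 2))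
  = Q ^+ psum (fun i => 'C(lam i, 2)) m *
    \prod_(i < m) qbinom Q^-1 (lam i - lam i.+1) (lam i - mu i).
Proof.
move=> UN Um rkU lam_mu lam0 Q; rewrite (card_step UN Um rkU lam_mu) -/Q.
rewrite big_split /= mulrAC; congr (_ * _).
rewrite -(nstat_interlacing lam_mu) lam0 mul0n addn0 -addnA [RHS]exprD; congr (_ * _).
  by rewrite expr_sum.
congr (_ ^+ (_ + 'C(_, 2))).
by rewrite -(psumB (fun r rm => proj2 (andP (lam_mu r rm)))) addKn.
Qed.

(** Stability under [N] is included because [card_step_exp] asks it of the upper space of a step. *)
Definition has_type (F : fieldType) (n : nat) (N : 'M[F]_n) (mu : nat -> nat) (V : 'M[F]_n) :=
  [&& <<V>>%MS == V, (V *m N <= V)%MS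
    & [forall i : 'I_n.+1, \rank (V :&: kermx (N ^+ i))%MS == psum mu i]].

Definition strict_step (F : fieldType) (n : nat) (N H V : 'M[F]_n) :=
  (H <= V)%MS && (V *m N <= H)%MS.

Section Count.
Variables (F : finFieldType) (n k : nat) (N : 'M[F]_n) (mu : nat -> nat -> nat)
  (alpha : nat -> nat).
Hypotheses (Nn : N ^+ n = 0)
  (mu_lace : forall j r, (j < k)%N -> (mu j.+1 r.+1 <= mu j r <= mu j.+1 r)%N)
  (mu_n : forall j r, (j <= k)%N -> (n <= r)%N -> mu j r = 0%N)
  (mu0 : forall r, mu 0%N r = 0%N)
  (mu_alpha : forall j, (j <= k)%N -> psum (mu j) n = psum alpha j).

Let Q : rat := #|F|%:R.

Lemma rank_has_type j V : has_type N (mu j) V -> \rank V = psum (mu j) n.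
Proof.
move=> /and3P[_ _ /forallP/(_ ord_max)/eqP <-] /=.
apply/esym/eqmx_rank/eqmxP/capmx_idPl.
by rewrite Nn sub_kermx mulmx0.
Qed.

Lemma card_type0 : #|[set V | has_type N (mu 0%N) V]| = 1%N.
Proof.
have mu00 i : psum (mu 0) i = 0%N by rewrite /psum big1.
apply/eqP/cards1P; exists 0; apply/setP => V; rewrite !inE; apply/idP/eqP => [hV|->].
  by apply/eqP; rewrite -mxrank_eq0 (rank_has_type hV) mu00.
rewrite /has_type genmx0 mul0mx sub0mx eqxx /=; apply/forallP => i.
by rewrite cap0mx mxrank0 mu00.
Qed.

Lemma card_strict_step j V : (j < k)%N -> has_type N (mu j.+1) V ->
  #|[set H | has_type N (mu j) H & strict_step N H V]|%:R
   = Q ^+ psum (fun i => 'C(mu j.+1 i, 2)) n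
     / Q ^+ (psum (fun i => 'C(mu j i, 2)) n + 'C(alpha j, 2))
     * \prod_(i < n) qbinom Q^-1 (mu j.+1 i - mu j.+1 i.+1) (mu j.+1 i - mu j i).
Proof.
move=> jk /and3P[_ VN /forallP rkV].
have Vn : (V <= kermx (N ^+ n))%MS by rewrite Nn sub_kermx mulmx0.
have lace r : (r < n)%N -> (mu j.+1 r.+1 <= mu j r <= mu j.+1 r)%N by move=> _; exact: mu_lace.
have Q0 : Q != 0 by rewrite pnatr_eq0 -lt0n (ltnW (card_finNzRing_gt1 F)).
(* The type records exponents up to [n]; at [n.+1] nothing changes, since [N ^+ n = 0] and
   [mu j.+1 n = 0]. *)
have rk i : (i <= n.+1)%N -> \rank (V :&: kermx (N ^+ i))%MS = psum (mu j.+1) i.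
  case: (ltngtP i n.+1) => // [lin _|-> _]; first exact/eqP/(rkV (Ordinal lin)).
  rewrite psumS mu_n // addn0 exprS Nn mulr0.
  by have /eqP <- := rkV ord_max; rewrite /= Nn.
have := card_step_exp VN Vn rk lace (mu_n jk (leqnn _)).
rewrite -/Q !mu_alpha // 1?ltnW // psumS addKn => E.
rewrite mulrAC -E mulfK ?expf_neq0 //; congr (_%:R); apply: eq_card => H; rewrite !inE.
rewrite /has_type /strict_step; case: eqP => //= _.
apply/idP/idP => [/andP[/andP[_ ->] /andP[-> ->]]//|/and3P[HV VH ->]].
(* Stability of [H] comes from the step itself: [H *m N <= V *m N <= H]. *)
by rewrite HV VH !andbT (submx_trans _ VH) // submxMr.
Qed.

(** The differences [n(mu j.+1) - n(mu j)] telescope from [n(mu 0) = 0], and only the binomials of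
    the [alpha j] stay behind. *)
Lemma card_type_chains U : has_type N (mu k) U ->
  #|[set f : {ffun 'I_k.+1 -> 'M[F]_n} |
      chain (fun j => has_type N (mu j)) (strict_step N) f & f ord_max == U]|%:R
    * Q ^+ psum (fun j => 'C(alpha j, 2)) k
  = Q ^+ psum (fun i => 'C(mu k i, 2)) n *
    \prod_(j < k) \prod_(i < n)
      qbinom Q^-1 (mu j.+1 i - mu j.+1 i.+1) (mu j.+1 i - mu j i).
Proof.
move=> hU; rewrite (card_chains card_type0 card_strict_step hU).
have Q0 : Q != 0 by rewrite pnatr_eq0 -lt0n (ltnW (card_finNzRing_gt1 F)).
rewrite big_split /= mulrAC; congr (_ * _).
elim: (k) => [|m IHm].
  by rewrite big_ord0 mul1r psum0 /psum big1 // => i _; rewrite mu0.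
rewrite big_ord_recr /= psumS !exprD mulrACA IHm; field.
by rewrite !expf_neq0.
Qed.
End Count.

(** * Semistandard tableaux *)

(** Because [G 0 = 0], the default 0 of [nth] lets a sequence be padded to any length. *)
Lemma sum_nth_nat (G : nat -> nat) (s : seq nat) : G 0%N = 0%N ->
  forall n, (size s <= n)%N -> psum (fun i => G (nth 0%N s i)) n = (\sum_(x <- s) G x)%N.
Proof.
move=> G0 n sn; rewrite (big_nth 0) big_mkord -(subnKC sn) /psum big_split_ord /=.
by rewrite [X in (_ + X)%N]big1 ?addn0 // => i _; rewrite nth_default ?leq_addr.
Qed.

Lemma sumn_psum (s : seq nat) : sumn s = psum (nth 0%N s) (size s).
Proof. by rewrite (sum_nth_nat (G := id)) // sumnE. Qed.

Lemma size_partition (s : seq nat) : is_partition s -> (size s <= sumn s)%N.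
Proof.
case/andP => _; elim: s => //= x s IHs /andP[x0 /IHs sle].
by rewrite -add1n leq_add.
Qed.

(** In a weakly increasing row the entries at most [j] form an initial segment. *)
Lemma sorted_leq_count (s : seq nat) (j c : nat) : sorted leq s ->
  (c < count (fun x => x <= j)%N s)%N = (c < size s)%N && (nth 0%N s c <= j)%N.
Proof.
elim: s c => [|x s IHs] c; first by rewrite ltn0.
move=> /= xs; have ss := path_sorted xs.
case: (leqP x j) => xj; last first.
  have -> : count (fun x => x <= j)%N s = 0%N.
    apply/eqP; rewrite -leqn0 leqNgt -has_count; apply/hasPn => y ys.
    rewrite -ltnNge (leq_trans xj) //.
    by move: xs; rewrite (path_sortedE leq_trans) => /andP[/allP/(_ y ys)].
  case: c => [|c] /=; first by rewrite [(x <= j)%N]leqNgt xj.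
  apply/esym/negbTE/negP => /andP[cs]; apply/negP; rewrite -ltnNge (leq_trans xj) //.
  move: xs; rewrite (path_sortedE leq_trans) => /andP[/allP h _]; apply: h.
  exact: mem_nth.
by case: c => [|c] /=; rewrite add1n ltnS ?IHs // xj.
Qed.

Lemma count_leqS (j : nat) (s : seq nat) :
  count (fun x => x <= j.+1)%N s = (count (fun x => x <= j)%N s + count_mem j.+1 s)%N.
Proof.
rewrite -count_predUI [X in (_ + X)%N](eq_count (a2 := pred0)) ?count_pred0 ?addn0.
  by apply: eq_count => x /=; rewrite leq_eqVlt orbC ltnS.
by move=> x /=; case: eqP => [->|]; rewrite ?andbF ?ltnn.
Qed.

Section Tableau.
Variables (T : seq (seq nat)).
Hypothesis ssyt : is_ssyt T.

Lemma ssyt_row_sorted r : sorted leq (row_of T r).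
Proof.
case/and3P: ssyt => _ /allP rows _; rewrite /row_of.
case: (ltnP r (size T)) => rT; last by rewrite nth_default.
by have /andP[] := rows _ (mem_nth [::] rT).
Qed.

Lemma ssyt_row_pos r : all (fun x => 0 < x)%N (row_of T r).
Proof.
case/and3P: ssyt => _ /allP rows _; rewrite /row_of.
case: (ltnP r (size T)) => rT; last by rewrite nth_default.
by have /andP[] := rows _ (mem_nth [::] rT).
Qed.

Lemma size_row r : size (row_of T r) = nth 0%N (shape T) r.
Proof.
rewrite /row_of /shape; case: (ltnP r (size T)) => rT; first by rewrite (nth_map [::]).
by rewrite !nth_default // size_map.
Qed.

Lemma ltn_Tsh j r c :
  (c < Tsh T j r)%N = (c < size (row_of T r))%N && (nth 0%N (row_of T r) c <= j)%N.
Proof. exact/sorted_leq_count/ssyt_row_sorted. Qed.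

Lemma Tsh_mono j r : (Tsh T j r <= Tsh T j.+1 r)%N.
Proof. by apply: sub_count => x /= xj; rewrite leqW. Qed.

Lemma Tsh0 r : Tsh T 0 r = 0%N.
Proof.
apply/eqP; rewrite -leqn0 leqNgt -has_count; apply/hasPn => x /(allP (ssyt_row_pos r)).
by rewrite -ltnNge.
Qed.

Lemma Tsh_size j r : (size T <= r)%N -> Tsh T j r = 0%N.
Proof. by move=> rT; rewrite /Tsh /row_of nth_default. Qed.

(** By column strictness, a box of row [r.+1] with entry at most [j.+1] lies below an entry at most
    [j]. The proof looks at column [Tsh T j r], where row [r] has no such entry. *)
Lemma Tsh_interlace j r : (Tsh T j.+1 r.+1 <= Tsh T j r)%N.
Proof.
rewrite leqNgt ltn_Tsh; apply/negP => /andP[].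
set c := Tsh T j r => cs cj.
have rT : (r.+1 < size T)%N.
  by rewrite ltnNge; apply/negP => /(nth_default [::]) rT; rewrite /row_of rT in cs.
case/and3P: ssyt => /andP[sh _] _ /allP/(_ r); rewrite mem_iota /= add0n => /(_ (ltnW rT)).
move=> /allP/(_ c); rewrite mem_iota /= add0n => /(_ cs) lt.
have cs' : (c < size (row_of T r))%N.
  apply: leq_trans cs _; rewrite !size_row.
  have geq_tr : transitive geq by move=> a b d /= ba ad; exact: leq_trans ad ba.
  by apply: (sorted_leq_nth geq_tr leqnn 0%N sh); rewrite ?inE ?size_map ?rT ?(ltnW rT).
have : (c < Tsh T j r)%N by rewrite ltn_Tsh cs' -ltnS (leq_trans lt cj).
by rewrite ltnn.
Qed.

Lemma psum_Tsh j n : (size T <= n)%N ->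
  psum (Tsh T j) n = count (fun x => x <= j)%N (flatten T).
Proof.
move=> Tn; rewrite count_flatten sumnE big_map (big_nth [::]) big_mkord.
rewrite -(subnKC Tn) /psum big_split_ord /=.
by rewrite [X in (_ + X)%N]big1 ?addn0 // => i _; rewrite Tsh_size // leq_addr.
Qed.

Variable alpha : seq nat.
Hypothesis content : has_content T alpha.

Lemma content_psum j n : (size T <= n)%N -> (j <= size alpha)%N ->
  psum (Tsh T j) n = psum (nth 0%N alpha) j.
Proof.
move=> Tn; rewrite psum_Tsh //; case/andP: content => /allP cnt _.
elim: j => [_|j IHj jk].
  rewrite psum0 -(psum_Tsh 0 (leqnn _)) /psum big1 // => i _; exact: Tsh0.
rewrite psumS -IHj 1?ltnW //.
have := cnt j; rewrite mem_iota /= add0n => /(_ jk)/eqP <-.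
exact: count_leqS.
Qed.

Lemma Tsh_max r : Tsh T (size alpha) r = nth 0%N (shape T) r.
Proof.
rewrite -size_row /Tsh; apply/eqP; rewrite -all_count.
case/andP: content => _ /allP le; apply/allP => x xr; apply: le.
case: (ltnP r (size T)) => rT; last by rewrite /row_of nth_default in xr.
by apply/flattenP; exists (row_of T r) => //; exact: mem_nth.
Qed.

(** The added factors are all 1: rows past the last are empty, and past the largest entry the shape
    no longer grows, so the lower index is 0. *)
Lemma wt_prod (q : rat) n : 0 < q -> (size T <= n)%N ->
  wt q T = \prod_(j < size alpha) \prod_(i < n)
    qbinom q (Tsh T j.+1 i - Tsh T j.+1 i.+1) (Tsh T j.+1 i - Tsh T j i).
Proof.
move=> q0 Tn; rewrite exchange_big /= -(subnKC Tn) big_split_ord /=.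
rewrite [X in _ * X]big1 ?mulr1 => [|i _]; last first.
  by rewrite big1 // => j _; rewrite !Tsh_size ?leqW ?leq_addr // qbinomn0.
apply: eq_bigr => i _.
have mk : (max_entry T <= size alpha)%N.
  case/andP: content => _ /allP le; rewrite /max_entry.
  by apply/bigmax_leqP_seq => x xT _; exact: le.
rewrite big_add1 /= big_mkord -(subnKC mk) big_split_ord /=.
rewrite [X in _ = _ * X]big1 ?mulr1 // => j _.
suff E l : (max_entry T <= l)%N -> Tsh T l i = size (row_of T i).
  by rewrite !E ?subnn ?qbinomn0 // ?leqW // leq_addr.
move=> ml; apply/eqP; rewrite -all_count; apply/allP => x xr.
apply: leq_trans ml; apply: leq_bigmax_seq => //.
by apply/flattenP; exists (row_of T i) => //; exact: mem_nth.
Qed.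
End Tableau.

(** * The flags with a given tableau *)

(** All parts of [lam] lie among the first [n], so the kernel of [N ^+ n] has dimension [n]. *)
Lemma JF_nilpotent (F : fieldType) (n : nat) (N : 'M[F]_n) (lam : seq nat) :
  (size lam <= n)%N -> sumn lam = n ->
  (forall j, psum (nth 0%N lam) j = \rank (kermx (N ^+ j))) -> N ^+ n = 0.
Proof.
move=> szl suml JF; have := JF n.
rewrite (sum_nth_nat (G := id)) // -sumnE suml => rkn.
have : row_full (kermx (N ^+ n)) by rewrite /row_full -rkn //.
by rewrite -sub1mx sub_kermx mul1mx => /eqP.
Qed.

Section Fibers.
Variables (F : finFieldType) (n : nat) (alpha : seq nat) (N : 'M[F]_n).
Hypotheses (Nn : N ^+ n = 0) (sum_alpha : sumn alpha = n).
Local Notation k := (size alpha).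

Lemma rank_flag (Fl : {ffun 'I_k.+1 -> 'M[F]_n}) (i : 'I_k.+1) : is_flag alpha Fl ->
  <<Fl i>>%MS = Fl i /\ \rank (Fl i) = psum (nth 0%N alpha) i.
Proof. by case/andP => /forallP/(_ i)/andP[/eqP c /eqP r] _. Qed.

Lemma flag_full (Fl : {ffun 'I_k.+1 -> 'M[F]_n}) : is_flag alpha Fl -> Fl ord_max = 1%:M.
Proof.
move=> /(rank_flag ord_max)[c]; rewrite -sumn_psum sum_alpha => rk.
by rewrite -c -(genmx1 F n); apply/genmxP; rewrite submx1 sub1mx /row_full rk eqxx.
Qed.

Lemma flag_stable (Fl : {ffun 'I_k.+1 -> 'M[F]_n}) (i : 'I_k.+1) :
  is_flag alpha Fl -> strictly_compatible N Fl -> (Fl i *m N <= Fl i)%MS.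
Proof.
move=> flF /forallP sc; case: i => -[|i] ik.
  have [_ /=] := rank_flag (Ordinal ik) flF.
  by rewrite psum0 => /eqP; rewrite mxrank_eq0 => /eqP ->; rewrite mul0mx sub0mx.
have /andP[_ /forallP/(_ (Ordinal (ik : (i < k)%N)))/= le] := flF.
have := sc (Ordinal (ik : (i < k)%N)); move=> /= /submx_trans/(_ le).
by have -> : inord i.+1 = Ordinal ik by apply: val_inj; rewrite /= inordK.
Qed.

(** From flag to chain, strict compatibility gives stability and the sum of [alpha] makes the top
    space full. Backwards, the content of [T] turns the types into the dimensions of a flag. *)
Lemma JF_flag_chain (T : seq (seq nat)) (Fl : {ffun 'I_k.+1 -> 'M[F]_n}) :
  is_ssyt T -> has_content T alpha -> (size T <= n)%N ->
  [&& is_flag alpha Fl, strictly_compatible N Fl & JF_flag_is N Fl T] =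
  chain (fun j => has_type N (Tsh T j)) (strict_step N) Fl && (Fl ord_max == 1%:M).
Proof.
move=> ssyt content Tn; apply/and3P/andP.
  move=> [flF sc /forallP JF]; split; last by rewrite flag_full.
  apply/andP; split; apply/forallP => i.
    have [cFi _] := rank_flag i flF.
    rewrite /has_type cFi eqxx flag_stable //; apply/forallP => j.
    by have /forallP/(_ j)/eqP <- := JF i.
  case/andP: flF => _ /forallP/(_ i); rewrite /strict_step => ->.
  by have /forallP/(_ i) := sc.
move=> [/andP[/forallP ty /forallP st] _]; split.
- apply/andP; split; apply/forallP => i.
    have /and3P[-> _ _] := ty i; rewrite (rank_has_type Nn (ty i)) /=.
    rewrite (content_psum ssyt content) //; last exact: (ltn_ord i).
  by case/andP: (st i).
- by apply/forallP => i; case/andP: (st i).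
apply/forallP => i; apply/forallP => j; rewrite eq_sym.
by have /and3P[_ _ /forallP/(_ j)] := ty i.
Qed.

Lemma wt_card_fiber (lam : seq nat) (T : seq (seq nat)) :
  (size lam <= n)%N -> (forall j, psum (nth 0%N lam) j = \rank (kermx (N ^+ j))) ->
  is_ssyt T -> shape T = lam -> has_content T alpha ->
  let Q : rat := #|F|%:R in
  #|[set Fl : {ffun 'I_k.+1 -> 'M[F]_n} |
            [&& is_flag alpha Fl, strictly_compatible N Fl & JF_flag_is N Fl T]]|%:R
    * Q ^+ nstat alpha = Q ^+ nstat lam * wt Q^-1 T.
Proof.
move=> szl JF ssyt shT content Q.
have Tn : (size T <= n)%N by rewrite -(size_map size T) -/(shape T) shT.
have Q_gt0 : 0 < Q by rewrite ltr0n (ltnW (card_finNzRing_gt1 F)).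
rewrite (wt_prod content _ Tn) ?invr_gt0 //.
have full : has_type N (Tsh T k) 1%:M.
  rewrite /has_type genmx1 eqxx submx1 /=; apply/forallP => i.
  rewrite cap1mx -JF; apply/eqP; apply: eq_bigr => j _.
  by rewrite (Tsh_max content) shT.
have := card_type_chains Nn _ _ _ _ full (alpha := nth 0%N alpha).
rewrite !(sum_nth_nat (G := fun x => 'C(x, 2))) // -/(nstat alpha) -/Q.
have -> : psum (fun i => 'C(Tsh T k i, 2)) n = nstat lam.
  rewrite /nstat -(sum_nth_nat (G := fun x => 'C(x, 2)) _ szl) //.
  by apply: eq_bigr => i _; rewrite (Tsh_max content) shT.
move=> <- //; first congr (_%:R * _).
- by apply: eq_card => Fl; rewrite !inE JF_flag_chain.
- by move=> j r _; rewrite Tsh_interlace // Tsh_mono.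
- by move=> j r _ nr; rewrite Tsh_size // (leq_trans Tn).
- exact: Tsh0.
by move=> j jk; rewrite (content_psum ssyt content).
Qed.
End Fibers.

Lemma expz_invB (Q : rat) (a b : nat) : Q != 0 ->
  Q^-1 ^ (a%:Z - b%:Z) = Q ^+ b / Q ^+ a.
Proof.
move=> Q0; rewrite expfzDr ?invr_eq0 // -exprnP exprVn mulrC; congr (_ * _).
by rewrite -invr_expz -exprnP exprVn invrK.
Qed.

(** * The tableau of a flag *)

Lemma mem_words m s t : (t \in words m s) = (size t == m) && all (mem s) t.
Proof.
elim: m t => [|m IHm] t /=; first by case: t => [|x t]; rewrite inE.
apply/allpairsP/idP => [[[x u] /= [xs]]|].
  by rewrite IHm => /andP[/eqP us uall] ->; rewrite /= us eqxx xs.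
case: t => // x t /= /andP[st /andP[xs tall]]; exists (x, t).
by split=> //=; rewrite IHm tall andbT.
Qed.

Lemma uniq_words m s : uniq s -> uniq (words m s).
Proof.
move=> us; elim: m => //= m IHm; apply: allpairs_uniq => //.
by move=> [x u] [y v] _ _ /= [-> ->].
Qed.

Lemma mem_fillings lam k T :
  (T \in fillings lam k) = (shape T == lam) && all (all (mem (iota 1 k))) T.
Proof.
elim: lam T => [|m lam IHl] T /=; first by case: T => [|x t]; rewrite inE.
apply/allpairsP/idP => [[[x u] /= []]|].
  rewrite mem_words IHl => /andP[/eqP <- xall] /andP[/eqP us uall] ->.
  by rewrite /= us xall uall eqxx.
case: T => // x t /= /andP[/eqP[sx st] /andP[xall tall]]; exists (x, t).
by split=> //=; rewrite ?mem_words ?IHl ?sx ?st ?xall ?tall eqxx.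
Qed.

Lemma uniq_fillings lam k : uniq (fillings lam k).
Proof.
elim: lam => //= m lam IHl; apply: allpairs_uniq => //; first exact/uniq_words/iota_uniq.
by move=> [x u] [y v] _ _ /= [-> ->].
Qed.

(** The entry of box [(r, c)] is the least [j] with [c < Tsh T j r], and it is at most [k]. *)
Lemma Tsh_inj T T' k : is_ssyt T -> is_ssyt T' -> shape T = shape T' ->
  all (all (fun x => x <= k)%N) T -> all (all (fun x => x <= k)%N) T' ->
  (forall j r, (j <= k)%N -> Tsh T j r = Tsh T' j r) -> T = T'.
Proof.
move=> ssT ssT' sh leT leT' eqT.
have szT : size T = size T' by have := congr1 size sh; rewrite !size_map.
have szr r : size (row_of T r) = size (row_of T' r) by rewrite !size_row sh.
apply: (@eq_from_nth _ [::]) => // r rT.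
apply: (@eq_from_nth _ 0%N) => [|c cr]; first exact: szr.
have lek T1 : (r < size T1)%N -> (c < size (row_of T1 r))%N ->
    all (all (fun x => x <= k)%N) T1 -> (nth 0%N (row_of T1 r) c <= k)%N.
  by move=> rT1 cT1 /allP/(_ _ (mem_nth [::] rT1))/allP; apply; exact: mem_nth.
have cr' : (c < size (row_of T' r))%N by rewrite -szr.
have E j : (j <= k)%N -> (nth 0%N (row_of T r) c <= j)%N = (nth 0%N (row_of T' r) c <= j)%N.
  by move=> jk; have := eqT j r jk => /(congr1 (fun x => c < x)%N); rewrite !ltn_Tsh // cr cr'.
have rT' : (r < size T')%N by rewrite -szT.
apply/eqP; rewrite eqn_leq.
by rewrite E ?leqnn ?(lek T') // -E ?leqnn // (lek T).
Qed.

(** * The tableau of an interlacing chain of partitions *)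

Section BuildTableau.
Variables (k : nat) (lam : seq nat) (mu : nat -> nat -> nat).
Hypotheses (part : is_partition lam) (mu0 : forall r, mu 0%N r = 0%N)
  (muk : forall r, mu k r = nth 0%N lam r)
  (mu_lace : forall j r, (j < k)%N -> (mu j.+1 r.+1 <= mu j r <= mu j.+1 r)%N).

(* A box (r, c) is filled at the first level whose shape contains it. *)
Let entry r c := find (fun j => c < mu j r)%N (iota 0 k.+1).

Definition tableau_of :=
  mkseq (fun r => mkseq (entry r) (nth 0%N lam r)) (size lam).

Lemma row_tableau_of r : row_of tableau_of r = mkseq (entry r) (nth 0%N lam r).
Proof.
rewrite /row_of; case: (ltnP r (size lam)) => rl; first by rewrite nth_mkseq.
by rewrite !nth_default // size_mkseq.
Qed.

Lemma mu_mono i j r : (i <= j)%N -> (j <= k)%N -> (mu i r <= mu j r)%N.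
Proof.
move=> /subnKC <-; elim: (j - i)%N => [|d IHd]; first by rewrite addn0.
rewrite addnS => ij; apply: leq_trans (IHd (ltnW ij)) _.
by case/andP: (mu_lace r ij).
Qed.

(** Shapes grow with the level, so the levels that contain a given box form a final segment. *)
Lemma entry_leq r c j : (c < nth 0%N lam r)%N -> (j <= k)%N ->
  (entry r c <= j)%N = (c < mu j r)%N.
Proof.
move=> cr jk; have hs : has (fun j => c < mu j r)%N (iota 0 k.+1).
  by apply/hasP; exists k; rewrite ?mem_iota ?ltnSn //= muk.
apply/idP/idP => [ej|cj].
  have := nth_find 0%N hs; rewrite -/(entry r c) nth_iota ?add0n ?ltnS ?(leq_trans ej) //.
  by move=> /leq_trans; apply; exact: mu_mono.
rewrite leqNgt; apply/negP => /(before_find 0%N).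
by rewrite nth_iota ?ltnS // add0n cj.
Qed.

Lemma entry_bounds r c : (c < nth 0%N lam r)%N -> (0 < entry r c <= k)%N.
Proof.
move=> cr; rewrite (entry_leq cr (leqnn k)) muk cr andbT ltnNge.
by rewrite (entry_leq cr (leq0n k)) mu0.
Qed.

Lemma shape_tableau_of : shape tableau_of = lam.
Proof.
apply: (@eq_from_nth _ 0%N); rewrite size_map size_mkseq // => r rl.
by rewrite (nth_map [::]) ?size_mkseq // nth_mkseq // size_mkseq.
Qed.

Lemma sorted_tableau_of r : sorted leq (row_of tableau_of r).
Proof.
rewrite row_tableau_of; apply/(sortedP 0%N) => c; rewrite size_mkseq => cs.
have /andP[_ ek] := entry_bounds cs; rewrite !nth_mkseq ?(ltnW cs) // entry_leq ?(ltnW cs) //.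
by apply: (@leq_trans c.+2) => //; rewrite -entry_leq.
Qed.

Lemma tableau_of_bounds : all (all (fun x => 0 < x <= k)%N) tableau_of.
Proof.
apply/(all_nthP [::]) => r; rewrite size_mkseq => rl; rewrite nth_mkseq //.
apply/(all_nthP 0%N) => c; rewrite size_mkseq => cl; rewrite nth_mkseq //.
exact: entry_bounds.
Qed.

Lemma tableau_of_ssyt : is_ssyt tableau_of.
Proof.
apply/and3P; split; first by rewrite shape_tableau_of.
  apply/(all_nthP [::]) => r rT; rewrite sorted_tableau_of /=.
  have /(all_nthP [::])/(_ r rT) := tableau_of_bounds.
  by apply: sub_all => x /andP[].
apply/allP => r _; apply/allP => c; rewrite mem_iota add0n leq0n andTb => cr.
move: cr; rewrite !row_tableau_of size_mkseq => cr1.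
(* The box above exists: interlacing at level [k.-1] gives [mu k r.+1 <= mu k.-1 r <= mu k r], and
   [k] is positive because entries lie between 1 and [k]. *)
have cr : (c < nth 0%N lam r)%N.
  have /andP[e0 ek] := entry_bounds cr1.
  have : (c < mu k r.+1)%N by rewrite muk.
  rewrite -muk => /leq_trans; apply.
  have := mu_lace r (_ : k.-1 < k)%N; rewrite prednK; last by apply: leq_trans ek.
  by rewrite leqnn => /(_ isT)/andP[l1 l2]; exact: leq_trans l2.
rewrite !nth_mkseq //; have /andP[] := entry_bounds cr1.
set e := entry r.+1 c; case E : e => [|j] // _ jk.
rewrite ltnS (entry_leq cr (ltnW jk)).
(* Column strictness: a box present in row [r.+1] at level [j.+1] has the box above it present at
   level [j], by interlacing. *)
have : (c < mu j.+1 r.+1)%N by rewrite -(entry_leq cr1) // -/e E.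
by move=> /leq_trans; apply; case/andP: (mu_lace r jk).
Qed.

Lemma Tsh_tableau_of j r : (j <= k)%N -> Tsh tableau_of j r = mu j r.
Proof.
move=> jk; have lt c : (c < Tsh tableau_of j r)%N = (c < mu j r)%N.
  rewrite (ltn_Tsh tableau_of_ssyt) row_tableau_of size_mkseq.
  case: ltnP => cr; first by rewrite nth_mkseq // entry_leq.
  by apply/esym/negbTE; rewrite -leqNgt (leq_trans (mu_mono r jk (leqnn _))) // muk.
by apply/eqP; rewrite eqn_leq leqNgt lt ltnn leqNgt -lt ltnn.
Qed.

Lemma content_tableau_of (alpha : seq nat) n : size alpha = k -> (size lam <= n)%N ->
  (forall j, (j <= k)%N -> psum (mu j) n = psum (nth 0%N alpha) j) ->
  has_content tableau_of alpha.
Proof.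
move=> sa ln mua; apply/andP; split; last first.
  apply/allP => x /flattenP[row rowT xr]; rewrite sa.
  by have /allP/(_ row rowT)/allP/(_ x xr)/andP[] := tableau_of_bounds.
apply/allP => j; rewrite mem_iota add0n /= sa => jk.
have cnt i : (i <= k)%N -> count (fun x => x <= i)%N (flatten tableau_of) = psum (nth 0%N alpha) i.
  move=> ik; rewrite -(psum_Tsh _ (n := n)) ?size_mkseq // -mua //.
  by apply: eq_bigr => r _; rewrite Tsh_tableau_of.
have := cnt j.+1 jk; rewrite psumS -cnt 1?ltnW // => E; apply/eqP.
apply: (@addnI (count (fun x => x <= j)%N (flatten tableau_of))); rewrite -E.
exact/esym/count_leqS.
Qed.
End BuildTableau.

(* [N ^+ r] is injective modulo [ker N^r], so this is the part
   [dim (V :&: ker N^(r+1)) - dim (V :&: ker N^r)] of the Jordan type, in a form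
   that makes the interlacing inequalities inclusions of subspaces. *)
Definition type_part (F : fieldType) (n : nat) (N V : 'M[F]_n) (r : nat) : nat :=
  \rank ((V :&: kermx (N ^+ r.+1)) *m N ^+ r)%MS.

Lemma psum_type_part (F : fieldType) (n : nat) (N V : 'M[F]_n) (i : nat) :
  psum (type_part N V) i = \rank (V :&: kermx (N ^+ i))%MS.
Proof.
elim: i => [|i IHi].
  by rewrite psum0 ker_exp0 capmx0 mxrank0.
rewrite psumS IHi addnC -[RHS](mxrank_mul_ker _ (N ^+ i)); congr (_ + _)%N.
apply/esym/eqmx_rank/eqmxP; rewrite -capmxA.
by apply: cap_eqmx (eqmx_refl _) _; apply/capmx_idPr/ker_exp_le.
Qed.

(** The upper bound comes from [H <= V]. For the lower bound, [N] carries [V :&: kermx (N ^+ r.+2)]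
    onto [V *m N :&: kermx (N ^+ r.+1)], which lies in [H :&: kermx (N ^+ r.+1)]. *)
Lemma type_part_lace (F : fieldType) (n : nat) (N H V : 'M[F]_n) (r : nat) :
  strict_step N H V ->
  (type_part N V r.+1 <= type_part N H r <= type_part N V r)%N.
Proof.
case/andP => HV VNH; apply/andP; split; last by rewrite mxrankS // submxMr // capmxS.
have -> : type_part N V r.+1 = \rank ((V :&: kermx (N ^+ r.+2)) *m N *m N ^+ r)%MS.
  by rewrite -mulmxA mulmxE -exprS.
rewrite mxrankS // submxMr //.
by rewrite cap_ker_expS_mul capmxS.
Qed.

(** * Each strictly compatible flag has exactly one tableau *)

Section Unique.
Variables (F : finFieldType) (n : nat) (alpha lam : seq nat) (N : 'M[F]_n).
Hypotheses (Nn : N ^+ n = 0) (sum_alpha : sumn alpha = n)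
  (part : is_partition lam) (szl : (size lam <= n)%N)
  (JF : forall j, psum (nth 0%N lam) j = \rank (kermx (N ^+ j))).
Local Notation k := (size alpha).

Lemma JF_flag_exists (Fl : {ffun 'I_k.+1 -> 'M[F]_n}) :
  is_flag alpha Fl -> strictly_compatible N Fl ->
  exists T, [&& T \in fillings lam k, is_ssyt T, has_content T alpha & JF_flag_is N Fl T].
Proof.
move=> flF sc; pose mu j := type_part N (Fl (inord j)).
have flat : Fl (inord k) = 1%:M.
  by rewrite -(flag_full sum_alpha flF); congr (Fl _); apply: val_inj; rewrite /= inordK.
have rk j : (j <= k)%N -> \rank (Fl (inord j)) = psum (nth 0%N alpha) j.
  by move=> jk; have [_ ->] := rank_flag (inord j) flF; rewrite inordK.
have psum_mu j : (j <= k)%N -> psum (mu j) n = psum (nth 0%N alpha) j.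
  move=> jk; rewrite psum_type_part -rk //; apply/eqmx_rank/eqmxP/capmx_idPl.
  by rewrite Nn sub_kermx mulmx0.
have mu0 r : mu 0%N r = 0%N.
  apply/eqP; rewrite -leqn0 (leq_trans (mxrankM_maxl _ _)) //.
  by rewrite (leq_trans (mxrankS (capmxSl _ _))) // rk // psum0.
(* The top space is everything, so both sequences have the same partial sums. *)
have muk r : mu k r = nth 0%N lam r.
  apply: (@addnI (psum (mu k) r)); rewrite -psumS.
  have E i : psum (mu k) i = psum (nth 0%N lam) i.
    by rewrite psum_type_part flat JF cap1mx.
  by rewrite !E psumS.
have lace j r : (j < k)%N -> (mu j.+1 r.+1 <= mu j r <= mu j.+1 r)%N.
  move=> jk; apply: type_part_lace; rewrite /strict_step.
  case/andP: flF => _ /forallP/(_ (Ordinal jk)) /= ->.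
  by have /forallP/(_ (Ordinal jk)) := sc.
exists (tableau_of k lam mu); rewrite mem_fillings shape_tableau_of eqxx.
rewrite (tableau_of_ssyt part mu0 muk lace).
rewrite (content_tableau_of part mu0 muk lace erefl szl psum_mu).
rewrite /=; apply/andP; split.
  apply: sub_all (tableau_of_bounds mu0 muk lace) => row; apply: sub_all => x /=.
  by rewrite mem_iota add1n ltnS.
apply/forallP => i; apply/forallP => j; apply/eqP.
have -> : Fl i = Fl (inord i) by rewrite inord_val.
rewrite -psum_type_part; apply: eq_bigr => r _.
by rewrite (Tsh_tableau_of part mu0 muk lace) // -ltnS.
Qed.

Lemma JF_flag_unique (Fl : {ffun 'I_k.+1 -> 'M[F]_n}) T T' :
  T \in fillings lam k -> T' \in fillings lam k -> is_ssyt T -> is_ssyt T' ->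
  JF_flag_is N Fl T -> JF_flag_is N Fl T' -> T = T'.
Proof.
rewrite !mem_fillings => /andP[/eqP shT allT] /andP[/eqP shT' allT'] ssT ssT' JT JT'.
have le U : all (all (mem (iota 1 k))) U -> all (all (fun x => x <= k)%N) U.
  by apply: sub_all => row; apply: sub_all => x /=; rewrite mem_iota => /andP[_].
apply: (Tsh_inj ssT ssT' _ (le _ allT) (le _ allT')); first by rewrite shT.
(* [JF_flag_is] compares partial sums up to [n] only, which settles the rows below [n]; from row [n]
   on both tableaux are empty. *)
move=> j r jk; case: (ltnP r n) => rn; last first.
  have sz U : shape U = lam -> (size U <= r)%N.
    by move=> sU; rewrite -(size_map size U) -/(shape U) sU (leq_trans szl).
  by rewrite !Tsh_size ?sz.
have E i : (i <= n)%N -> psum (Tsh T j) i = psum (Tsh T' j) i.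
  move=> ni; move/forallP/(_ (inord j))/forallP/(_ (inord i))/eqP: JT.
  move/forallP/(_ (inord j))/forallP/(_ (inord i))/eqP: JT'.
  by rewrite !inordK // => /= E1 E2; rewrite /psum E1 E2.
by apply: (@addnI (psum (Tsh T j) r)); rewrite -psumS E // psumS -E // ltnW.
Qed.

(** Each flag is replaced by the sum over [T] of the indicator of [JF_flag_is], which is 1 by
    existence and uniqueness; then the two sums are exchanged. *)
Lemma card_flags_fibers :
  #|[set Fl : {ffun 'I_k.+1 -> 'M[F]_n} | is_flag alpha Fl && strictly_compatible N Fl]|
  = (\sum_(T <- fillings lam k | is_ssyt T && has_content T alpha)
      #|[set Fl : {ffun 'I_k.+1 -> 'M[F]_n} |
          [&& is_flag alpha Fl, strictly_compatible N Fl & JF_flag_is N Fl T]]|)%N.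
Proof.
rewrite -sum1_card.
transitivity (\sum_(Fl in [set Fl : {ffun 'I_k.+1 -> 'M[F]_n} |
    is_flag alpha Fl && strictly_compatible N Fl])
  \sum_(T <- fillings lam k | is_ssyt T && has_content T alpha) JF_flag_is N Fl T)%N.
  apply: eq_bigr => Fl; rewrite inE => /andP[flF sc].
  have [T /and4P[inT ssT cT JT]] := JF_flag_exists flF sc.
  rewrite -big_filter (bigD1_seq T) ?filter_uniq ?uniq_fillings ?mem_filter ?ssT ?cT //=.
  rewrite JT big1_seq // => T'; rewrite mem_filter => /andP[neT /andP[/andP[ssT' _] inT']].
  case JT' : (JF_flag_is N Fl T') => //.
  by rewrite (JF_flag_unique inT inT' ssT ssT' JT JT') eqxx in neT.
rewrite exchange_big /=; apply: eq_bigr => T _.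
rewrite -sum1_card big_mkcond [RHS]big_mkcond; apply: eq_bigr => Fl _; rewrite !inE andbA.
by case: (is_flag alpha Fl && strictly_compatible N Fl) => //=; case: JF_flag_is.
Qed.
End Unique.

Theorem theorem5p8 (F : finFieldType) (n : nat) (lam alpha : seq nat) (N : 'M[F]_n) :
  let q : rat := (#|F|%:R)^-1 in
  is_partition lam -> sumn lam = n ->
  (exists m : nat, N ^+ m = 0) -> JF_is N lam ->
  sumn alpha = n ->
  (forall T : seq (seq nat), is_ssyt T -> shape T = lam -> has_content T alpha ->
     wt q T = q ^ ((nstat lam)%:Z - (nstat alpha)%:Z) *
       #|[set Fl : {ffun 'I_(size alpha).+1 -> 'M[F]_n} |
            [&& is_flag alpha Fl, strictly_compatible N Fl & JF_flag_is N Fl T]]|%:R)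
  /\
  W_coeff q lam alpha = q ^ ((nstat lam)%:Z - (nstat alpha)%:Z) *
       #|[set Fl : {ffun 'I_(size alpha).+1 -> 'M[F]_n} |
            is_flag alpha Fl && strictly_compatible N Fl]|%:R.
Proof.
move=> q part suml _ JF sum_alpha.
have szl : (size lam <= n)%N by rewrite -suml size_partition.
have Nn := JF_nilpotent szl suml JF.
have Q0 : #|F|%:R != 0 :> rat by rewrite pnatr_eq0 -lt0n (ltnW (card_finNzRing_gt1 F)).
have fiber (T : seq (seq nat)) : is_ssyt T -> shape T = lam -> has_content T alpha ->
    wt q T = q ^ ((nstat lam)%:Z - (nstat alpha)%:Z) *
      #|[set Fl : {ffun 'I_(size alpha).+1 -> 'M[F]_n} |
          [&& is_flag alpha Fl, strictly_compatible N Fl & JF_flag_is N Fl T]]|%:R.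
  move=> ssT shT cT; have := wt_card_fiber Nn sum_alpha szl JF ssT shT cT.
  (* Passing from [q] to [Q] reverses the exponent: the prefactor is [Q ^+ nstat alpha] over
     [Q ^+ nstat lam], as the count in [wt_card_fiber] requires. *)
  rewrite expz_invB // -/q mulrAC [_ ^+ nstat alpha * _]mulrC => ->.
  by rewrite mulrAC mulfV ?mul1r ?expf_neq0.
split=> //; rewrite (card_flags_fibers Nn sum_alpha part szl JF) natr_sum mulr_sumr.
rewrite /W_coeff big_seq_cond [RHS]big_seq_cond; apply: eq_bigr => T /andP[].
by rewrite mem_fillings => /andP[/eqP shT _] /andP[ssT cT]; exact: fiber.
Qed.
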